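(* Let $k\ge2$ and $t\in[(k-1)r,kr)$. For every $n\ge2$, the cumulant $c^{(\lambda)}_{k,n}(kr-t;\ldots;kr-t)$ of order $n$ of $\sigma_k(t)$ satisfies $$\frac{c^{(\lambda)}_{k,n}(kr-t;\ldots;kr-t)}{\big(c^{(\lambda)}_{k,2}(kr-t;kr-t)\big)^{n/2}}\le(n!)^{k-2}\,O(\lambda^{1-n/2})$$ as $\lambda\to\infty$; that is, for every $n\ge2$ there exist $C_n>0$ and $\lambda_n>0$ such that the left-hand side is at most $(n!)^{k-2}C_n\lambda^{1-n/2}$ for all $\lambda>\lambda_n$.
   Context: Fix $r>0$. Nodes form a Poisson point process on $[0,kr]$ with constant intensity $\lambda>0$. Additional nodes are placed at $0$ and at $t\in[0,kr]$; two nodes are connected if and only if their distance is at most $r$. $\sigma_k(t)$ is the number of $k$-hops from $0$ to $t$, i.e. the number of $(k-1)$-tuples of Poisson nodes $0<x_1<\cdots<x_{k-1}<t$ with $x_{i+1}-x_i\le r$ for $i=0,\ldots,k-1$, where $x_0:=0$, $x_k:=t$. $c^{(\lambda)}_{k,n}(kr-t;\ldots;kr-t)$ (with $n$ equal arguments) is the $n$-th cumulant $\kappa(\sigma_k(t),\ldots,\sigma_k(t))$ of $\sigma_k(t)$ under intensity $\lambda$, where $\kappa(X_1,\ldots,X_n)=\sum_{l=1}^n(l-1)!(-1)^{l-1}\sum_{\pi_1\cup\cdots\cup\pi_l=\{1,\ldots,n\}}\prod_{j=1}^l\mathbb E[\prod_{i\in\pi_j}X_i]$ (sum over partitions into $l$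 blocks); in particular $c^{(\lambda)}_{k,2}(kr-t;kr-t)$ is the variance of $\sigma_k(t)$. The notation $f(\lambda)=O(\lambda^a)$ means that there exist constants $C>0$, $\lambda_0>0$ (which may depend on $a$ and on the fixed parameters) with $|f(\lambda)|\le C\lambda^a$ for all $\lambda>\lambda_0$. *)

(* Defs.v *)
From HB Require Import structures.
From mathcomp Require Import all_boot all_order all_algebra finmap.
From mathcomp Require Import all_classical all_reals all_analysis.

Set Implicit Arguments.
Unset Strict Implicit.
Unset Printing Implicit Defensive.

Import Order.TTheory GRing.Theory Num.Theory.
Import numFieldNormedType.Exports.

Local Open Scope classical_set_scope.
Local Open Scope ring_scope.

Definition count_in (R : realType) (B : set R) (X : {fset R}) : nat :=
  #|` [fset x in X | x \in B]%fset|.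

(* Poisson point process on [0, L] with constant intensity lam, as a random
   finite set of points: the intensity measure is finite and has no atoms, so
   configurations are finite and without multiple points.
   [poisson_prob m n] is the Poisson law of mean m (the Dirac mass at 0 when
   m = 0); its argument n is not used by the library.  In the independence
   clause, U i := setT covers the subfamilies of a family B. *)
Definition poisson_process (R : realType) (d : measure_display)
    (T : measurableType d) (P : probability T R) (L lam : R)
    (X : T -> {fset R}) : Prop :=
  [/\ forall w x, x \in X w -> 0 <= x <= L,
      forall B : set R, measurable B -> B `<=` `[0, L] ->
        measurable_fun [set: T] (fun w => count_in B (X w)),
      forall B : set R, measurable B -> B `<=` `[0, L] ->
        forall U : set nat,
          P [set w | U (count_in B (X w))] =
          poisson_prob (lam * fine (lebesgue_measure B)) 0%N U
    & forall (m : nat) (B : 'I_m -> set R),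
        (forall i, measurable (B i)) -> (forall i, B i `<=` `[0, L]) ->
        trivIset [set: 'I_m] B ->
        forall U : 'I_m -> set nat,
          P [set w | forall i, U i (count_in (B i) (X w))] =
          (\prod_(i < m) P [set w | U i (count_in (B i) (X w))])%E].

Definition hop (R : realType) (r : R) : rel R :=
  fun x y => (x < y) && (y - x <= r).

(* The number of tuples (x_1, ..., x_(k-1)) of points of X such that
   0 < x_1 < ... < x_(k-1) < t, all consecutive gaps of
   0, x_1, ..., x_(k-1), t being at most r. *)
Definition num_hops (R : realType) (r : R) (k : nat) (t : R) (X : {fset R})
    : nat :=
  #|[pred s : k.-1.-tuple X | path (hop r) 0 (rcons (map val s) t)]|.

(* The sums range over l and over the (unordered) partitions of {1, ..., n}
   into l nonempty blocks.  [fine] makes this total; the value is meaningful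
   when all the mixed moments are finite. *)
Definition joint_cumulant (R : realType) (d : measure_display)
    (T : measurableType d) (P : probability T R) (n : nat)
    (Y : 'I_n -> T -> R) : R :=
  \sum_(1 <= l < n.+1) (l.-1)`!%:R * (-1) ^+ l.-1 *
    \sum_(Q : {set {set 'I_n}} |
          finset.partition Q (finset.setTfor 'I_n) && (#|Q| == l))
      \prod_(A in Q) fine ('E_P[fun w => (\prod_(i in A) Y i w)%R])%E.

Definition cumulant (R : realType) (d : measure_display)
    (T : measurableType d) (P : probability T R) (n : nat) (Y : T -> R) : R :=
  joint_cumulant P (fun _ : 'I_n => Y).

(* The cumulant c_(k,n)(kr - t; ...; kr - t) of the number of k-hops to t. *)
Definition hop_cumulant (R : realType) (d : measure_display)
    (T : measurableType d) (P : probability T R) (X : T -> {fset R})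
    (r : R) (k : nat) (t : R) (n : nat) : R :=
  cumulant P n (fun w => (num_hops r k t (X w))%:R).

(* Main.v *)
Require Import Defs.
From HB Require Import structures.
From mathcomp Require Import all_boot all_order all_algebra.
From mathcomp Require Import ring lra zify.

Set Implicit Arguments.
Unset Strict Implicit.
Unset Printing Implicit Defensive.

Import Order.TTheory GRing.Theory Num.Theory.

Local Open Scope ring_scope.

(** Cut (0, t) into N cells of width h and record only which cells are occupied:
    these are N independent Bernoulli variables of parameter p = 1 - exp(-lam h),
    and the number of k-hops becomes a sum, over admissible increasing (k-1)-tuples
    c of cells, of the indicators that all cells of c are occupied.  If a cell hop
    is allowed as soon as some points of the two cells might be within distance r,
    this discrete count equals sigma_k(t) for every configuration once N is large;
    the moments converge by dominated convergence, and so do the cumulants.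

    A joint cumulant of indicators 1[U_i occupied] vanishes when the sets U_i split
    into two groups with disjoint unions, and is at most a constant times p^|union|
    otherwise; in the latter case |union| <= n(k-2) + 1.  As N p <= lam t, summing
    over the n-tuples of (k-1)-tuples gives |c_n| = O(lam^(n(k-2)+1)) uniformly in N.
    The variance is a sum of nonnegative covariances; the pairs of tuples sharing
    their first cell already contribute a multiple of lam^(2k-3).  The quotient of
    the two powers is lam^(1-n/2). *)

(** * Cumulants of a set function *)

Section SetCumulant.
Variables (R : comNzRingType) (I : finType).
Implicit Types (m : {set I} -> R) (S T C : {set I}) (Q : {set {set I}}).

(** The Möbius function of the partition lattice, from a partition into [l] blocks up to the
    one-block partition. *)
Definition block_coef (l : nat) : R := (-1) ^+ l.-1 * (l.-1)`!%:R.

(** When [m A] is the mixed moment of the variables indexed by [A], this is the joint cumulant of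
    those indexed by [S]. *)
Definition setcum m S : R :=
  \sum_(Q | partition Q S) block_coef #|Q| * \prod_(A in Q) m A.

Lemma sum_partition_containing S C (f : {set {set I}} -> R) :
  C \subset S -> C != set0 ->
  \sum_(Q | partition Q (S :\: C)) f Q =
  \sum_(Q | partition Q S && (C \in Q)) f (Q :\ C).
Proof.
move=> CS C0.
rewrite (reindex_onto (fun Q => Q :\ C) (fun Q => C |: Q)) /=; last first.
  move=> Q QS; rewrite setU1K //; apply/negP => CQ.
  have /subsetP := partitionS QS CQ.
  case/set0Pn: C0 => x xC /(_ x xC); by rewrite inE xC.
apply: eq_bigl => Q; apply/andP/andP => [[QS /eqP QE]|[QS CQ]].
  have CQ : C \in Q by rewrite -QE setU11.
  split=> //; rewrite -QE.
  have -> : S = C :|: (S :\: C) by rewrite setDE setUIr setUCr setIT; apply/esym/setUidPr.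
  apply: partitionU1 => //.
  by rewrite disjoint_sym disjoints_subset subDset setUCr subsetT.
by split; [exact: partitionD1|rewrite setD1K].
Qed.

(* The blocks C of a partition that avoid a cancel against the partitions with C
   removed, since (l - 1) (l - 2)! = (l - 1)!; only the one-block partition is left. *)
Lemma setcum_rec m S (a : I) : m set0 = 1 -> a \in S ->
  m S = \sum_(T : {set I} | (a \in T) && (T \subset S)) setcum m T * m (S :\: T).
Proof.
move=> m0 aS; rewrite (bigD1 S) ?aS ?subxx //= setDv m0 mulr1.
(* The proper subsets T are replaced by their complements C, nonempty sets avoiding [a]; each C then
   serves as one extra block of a partition of S. *)
rewrite (reindex_onto (fun C => S :\: C) (fun T => S :\: T)) /=; last first.
  by move=> T /andP[/andP[_ TS] _]; rewrite setDDr setDv set0U; apply/setIidPr.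
transitivity (setcum m S + \sum_(C : {set I} | [&& a \notin C, C \subset S & C != set0])
    \sum_(Q | partition Q S && (C \in Q)) block_coef #|Q|.-1 * \prod_(A in Q) m A); last first.
  congr (_ + _); apply: eq_big => [C|C /and3P[aC CS C0]].
    rewrite !inE aS andbT setDDr setDv set0U subsetDl andbT.
    rewrite -andbA (sameP eqP setIidPr); congr (_ && _); rewrite [RHS]andbC; apply: andb_id2l => CS.
    congr negb; rewrite (sameP eqP setDidPl) disjoint_sym -setI_eq0.
    by rewrite (setIidPl CS).
  rewrite setDDr setDv set0U (setIidPr CS) /setcum sum_partition_containing //.
  rewrite big_distrl /=; apply: eq_bigr => Q /andP[_ CQ].
  by rewrite -mulrA (big_setD1 C CQ) /= (cardsD1 C) CQ /= [X in _ * X]mulrC.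
rewrite (exchange_big_dep (fun Q => partition Q S)) /=; last by move=> ? ? _ /andP[].
rewrite -big_split /=.
have part1 : partition [set S] S.
  rewrite /partition /cover big_set1 eqxx trivIset1 inE eq_sym /=.
  by apply/set0Pn; exists a.
rewrite (bigD1 [set S]) //= cards1 /block_coef big_set1 expr0 !mul1r big1 ?addr0; last first.
  move=> C /andP[/and3P[aC _ _] /andP[_]]; rewrite inE => /eqP CS.
  by rewrite CS aS in aC.
rewrite big1 ?addr0 // => Q /andP[QS Q1].
have [tQ cQ] := (partition_trivIset QS, cover_partition QS).
have aQ : a \in cover Q by rewrite cQ.
rewrite [X in _ + X](eq_bigl (fun C => C \in Q :\ pblock Q a)); last first.
  move=> C; rewrite !inE QS /= andbC; have [CQ|] //= := boolP (C \in Q).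
    rewrite (partitionS QS CQ) (partition_neq0 QS CQ) andbT ?andbT; congr negb.
    apply/idP/eqP => [aC|->]; last by rewrite mem_pblock.
    by rewrite (def_pblock tQ CQ aC).
  by rewrite andbF.
(* For fixed Q the summand does not depend on C, so it is counted once for each block of Q other
   than the block of [a]. *)
rewrite big_const iter_addr_0.
have : #|Q| = #|Q :\ pblock Q a|.+1 by rewrite (cardsD1 (pblock Q a)) pblock_mem.
case E : #|Q :\ pblock Q a| => [|l] Ql.
  case/negP: Q1; have /cards1P[A QA] : #|Q| == 1%N by rewrite Ql.
  by rewrite -cQ QA /cover big_set1.
rewrite Ql /= factS natrM exprS; ring.
Qed.

(** Induction on the size of S, through [setcum_rec] at a point [a] of S in A. Proper subsets T that
    leave A have a zero cumulant by induction. Those inside A add up to m (S :&: A) * m (S :\: A) =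
    m S, which leaves nothing for the term T = S. *)
Lemma setcum_disconnected m A S :
  m set0 = 1 -> (forall T, m T = m (T :&: A) * m (T :\: A)) ->
  S :&: A != set0 -> S :\: A != set0 -> setcum m S = 0.
Proof.
move=> m0 mM; have [n] := ubnP #|S|; elim: n S => // n IHn S; rewrite ltnS => Sn.
case/set0Pn=> a /setIP[aS aA] SA0.
have := setcum_rec m0 aS; rewrite (bigD1 S) ?aS ?subxx //= setDv m0 mulr1.
rewrite (bigID (fun T : {set I} => T \subset A)) /= [X in _ + (_ + X)]big1 ?addr0; last first.
  move=> T /andP[/andP[/andP[aT TS] TS'] TA]; rewrite IHn ?mul0r //.
  - by apply: leq_trans Sn; apply: proper_card; rewrite properEneq TS'.
  - by apply/set0Pn; exists a; rewrite inE aT.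
  - by rewrite setD_eq0.
rewrite (_ : \sum_(T | _) _ = m S); last first.
  rewrite [RHS]mM (@setcum_rec m (S :&: A) a) ?inE ?aS // big_distrl /=.
  apply: eq_big => [T|T /andP[_ TA]].
    rewrite subsetI -!andbA; congr (_ && _); apply: andb_id2l => TS.
    apply: andb_idl => TA; apply: contraNneq SA0 => <-.
    by rewrite setD_eq0.
  rewrite -mulrA [m (S :\: T)]mM; congr (_ * (m _ * m _)).
    by apply/setP => x; rewrite !inE andbA.
  apply/setP => x; rewrite !inE; have [/(subsetP TA) ->|_] := boolP (x \in T); rewrite /= ?andbF //.
by move/eqP; rewrite -subr_eq subrr eq_sym => /eqP.
Qed.

Lemma eq_setcum m m' S : m =1 m' -> setcum m S = setcum m' S.
Proof. by move=> mm'; apply: eq_bigr => Q _; congr (_ * _); apply: eq_bigr. Qed.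

(* Expanding the product over the blocks of Q amounts to drawing an independent
   copy s A of the sample point for each block A. *)
Lemma setcum_sum (W J : finType) (w0 : W) (w : W -> R) (Y : J -> W -> R) :
  setcum (fun A => \sum_x w x * (\sum_j Y j x) ^+ #|A|) setT =
  \sum_(F : {ffun I -> J})
    setcum (fun A => \sum_x w x * \prod_(i in A) Y (F i) x) setT.
Proof.
rewrite /setcum exchange_big /=; apply: eq_bigr => Q QT.
rewrite -big_distrr /=; congr (_ * _).
(* The functions s choose a sample point for each block of Q and take the default value [w0]
   elsewhere. *)
rewrite (big_distr_big w0) /=.
under [RHS]eq_bigr do rewrite (big_distr_big w0) /=.
rewrite exchange_big /=; apply: eq_bigr => s _.
under [RHS]eq_bigr do rewrite big_split /=.
rewrite -big_distrr big_split /=; congr (_ * _).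
under eq_bigr do rewrite -prodr_const.
(* Each index reads the sample point of its own block, so the double product becomes one product
   over all indices, which can be expanded over the choices F. *)
have blockE (f : I -> W -> R) :
    \prod_(A in Q) \prod_(i in A) f i (s A) = \prod_i f i (s (pblock Q i)).
  rewrite -[RHS](eq_bigl _ _ (fun i => in_setT i)) (set_partition_big _ QT) /=.
  apply: eq_bigr => A AQ; apply: eq_bigr => i iA.
  by rewrite (def_pblock (partition_trivIset QT) AQ iA).
rewrite (blockE (fun i x => \sum_j Y j x)) bigA_distr_bigA /=.
by apply: eq_bigr => F _; rewrite (blockE (fun i x => Y (F i) x)).
Qed.

End SetCumulant.

(** * Independent Bernoulli cells *)

Lemma setcum2 (R : comNzRingType) (I : finType) (m : {set I} -> R) (a b : I) :
  m set0 = 1 -> a != b ->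
  setcum m [set a; b] = m [set a; b] - m [set a] * m [set b].
Proof.
move=> m0 ab.
have cum1 c : setcum m [set c] = m [set c].
  rewrite [RHS](@setcum_rec _ _ _ _ c) ?set11 // (big_pred1 [set c]) ?setDv ?m0 ?mulr1 //.
  by move=> T /=; rewrite eqEsubset sub1set andbC.
rewrite (@setcum_rec _ _ m [set a; b] a) ?setU11 //.
rewrite (bigD1 [set a; b]) ?setU11 ?subxx //= setDv m0 mulr1.
rewrite (big_pred1 [set a]) /= ?cum1; last first.
  move=> T /=; apply/andP/eqP => [[/andP[aT Tab] T1]|->]; last first.
    rewrite set11 subsetUl; split=> //; apply/negP => /eqP/setP/(_ b).
    by rewrite !inE eqxx orbT eq_sym (negbTE ab).
  apply/eqP; rewrite eqEsubset sub1set aT andbT; apply/subsetP => x xT.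
  move: (subsetP Tab x xT); rewrite !inE => /orP[//|/eqP xb].
  case/negP: T1; rewrite eqEsubset Tab; apply/subsetP => y.
  by rewrite !inE => /orP[] /eqP -> //; rewrite -xb.
have -> : [set a; b] :\: [set a] = [set b].
  apply/setP => x; rewrite !inE; case: eqVneq => //= ->; by rewrite (negbTE ab).
by rewrite addrK.
Qed.

Lemma leq_wexp2r (e m n : nat) : (m <= n -> m ^ e <= n ^ e)%N.
Proof. by case: e => // e mn; rewrite leq_exp2r. Qed.

(** * Size of the union of a connected family of sets *)

Section ConnectedFamilies.
Variables (V C : finType) (G : V -> {set C}).

Let union (A : {set V}) := \bigcup_(i in A) G i.

(** Indices are added one at a time. By connectedness some set outside the current subfamily meets
    its union, so it brings at most K new points; the first set brings at most K + 1. *)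
Lemma card_union_connected (K : nat) :
  (forall i, #|G i| <= K.+1)%N ->
  (forall A : {set V}, A != set0 -> ~: A != set0 -> ~~ [disjoint union A & union (~: A)]) ->
  (#|union setT| <= #|V| * K + 1)%N.
Proof.
move=> GK conn.
have [V0|V0] := posnP #|V|.
  rewrite /union big_pred0 ?cards0 // => x.
  by have := card0_eq V0 x; rewrite !inE.
suff grow j : (0 < j <= #|V|)%N ->
    exists2 A : {set V}, #|A| = j & (#|union A| <= j * K + 1)%N.
  have [|A AV] := grow #|V|; first by rewrite V0 leqnn.
  suff -> : A = setT by [].
  by apply/eqP; rewrite eqEcard subsetT cardsT AV leqnn.
elim: j => // -[_ _|j IHj /andP[_ jV]].
  have /card_gt0P[x _] := V0; exists [set x]; first by rewrite cards1.
  by rewrite /union big_set1 mul1n addn1.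
have [|A Aj AU] := IHj; first by rewrite /= ltnW.
have A0 : A != set0 by rewrite -card_gt0 Aj.
have AC0 : ~: A != set0 by rewrite -card_gt0 cardsCs setCK subn_gt0 Aj.
have := conn A A0 AC0; rewrite -setI_eq0 => /set0Pn[x /setIP[xA /bigcupP[i iA xi]]].
rewrite inE in iA; exists (i |: A); first by rewrite cardsU1 iA Aj.
have -> : union (i |: A) = G i :|: union A by rewrite /union big_setU1.
have : (0 < #|G i :&: union A|)%N by apply/card_gt0P; exists x; rewrite inE xi.
have := cardsUI (G i) (union A); have := GK i; move: AU; rewrite !mulSn; lia.
Qed.

End ConnectedFamilies.

Section Bernoulli.
Variables (R : realFieldType) (C : finType) (p : R).
Hypothesis p01 : 0 <= p <= 1.
Let p_ge0 : 0 <= p. Proof. by case/andP: p01. Qed.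
Let p_le1 : p <= 1. Proof. by case/andP: p01. Qed.

Definition bern_weight (S : {set C}) : R := p ^+ #|S| * (1 - p) ^+ #|~: S|.

(** The sum is the expansion of a product over the cells whose factor is p on A and p + (1 - p) = 1
    off A. *)
Lemma bern_weight_superset (A : {set C}) :
  \sum_S bern_weight S * (A \subset S)%:R = p ^+ #|A|.
Proof.
transitivity (\prod_i (p + (if i \in A then 0 else 1 - p))); last first.
  rewrite (bigID (mem A)) /= [X in _ * X]big1 ?mulr1; last first.
    by move=> i /negbTE ->; rewrite addrC subrK.
  rewrite -prodr_const; apply: eq_bigr => i ->; by rewrite addr0.
rewrite bigA_distr; apply: eq_bigr => S _.
have [/subsetP AS|/subsetPn[i iA iS]] := boolP (A \subset S); last first.
  by rewrite mulr0 (bigD1 i) //= (negbTE iS) iA mul0r.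
rewrite mulr1 /bern_weight -!prodr_const [RHS](bigID (mem S)) /=; congr (_ * _).
  by apply: eq_bigr => i ->.
apply: eq_big => [i|i]; rewrite inE // => iS.
by rewrite (negbTE iS) (contraNF (AS i) iS).
Qed.

Section Family.
Variables (J : finType) (U : J -> {set C}).

Definition bern_moment (m : nat) : R :=
  \sum_S bern_weight S * (\sum_j (U j \subset S)%:R) ^+ m.

Lemma prod_indicator_subset (V : finType) (A : pred V) (F : V -> J) (S : {set C}) :
  \prod_(i | A i) (U (F i) \subset S)%:R = (\bigcup_(i | A i) U (F i) \subset S)%:R :> R.
Proof.
elim/big_ind2: _ => //.
  by rewrite sub0set.
by move=> x B y D -> ->; rewrite subUset; do 2!case: (_ \subset _); rewrite ?mulr0 ?mul0r ?mulr1.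
Qed.

Lemma bern_momentE (m : nat) :
  bern_moment m = \sum_(F : {ffun 'I_m -> J}) p ^+ #|\bigcup_i U (F i)|.
Proof.
under [RHS]eq_bigr do rewrite -bern_weight_superset.
rewrite exchange_big /=; apply: eq_bigr => S _; rewrite -big_distrr /=; congr (_ * _).
rewrite -[X in _ ^+ X]card_ord -prodr_const bigA_distr_bigA /=.
by apply: eq_bigr => F _; rewrite prod_indicator_subset.
Qed.

Definition bern_cumulant (n : nat) : R :=
  setcum (fun A : {set 'I_n} => bern_moment #|A|) setT.

Lemma bern_cumulantE (n : nat) :
  bern_cumulant n = \sum_(F : {ffun 'I_n -> J})
    setcum (fun A => p ^+ #|\bigcup_(i in A) U (F i)|) setT.
Proof.
rewrite /bern_cumulant /bern_moment.
rewrite (setcum_sum _ set0 bern_weight (fun j S => (U j \subset S)%:R)).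
apply: eq_bigr => F _; apply: eq_setcum => A.
rewrite -bern_weight_superset; apply: eq_bigr => S _.
by rewrite prod_indicator_subset.
Qed.

Definition cumulant_const (n : nat) : R :=
  \sum_(Q : {set {set 'I_n}} | partition Q setT) `|block_coef R #|Q| |.

(** The unions over the blocks of a partition together cover the full union, so their sizes add up
    to at least its size; as p <= 1, each product of moments is at most p to the size of the full
    union. *)
Lemma norm_setcum_union (n : nat) (G : 'I_n -> {set C}) :
  `|setcum (fun A => p ^+ #|\bigcup_(i in A) G i|) setT|
    <= cumulant_const n * p ^+ #|\bigcup_i G i|.
Proof.
apply: le_trans (ler_norm_sum _ _ _) _; rewrite big_distrl /=.
apply: ler_sum => Q QT; rewrite normrM ler_wpM2l //.
rewrite ger0_norm ?prodr_ge0 // => [|A _]; last exact: exprn_ge0.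
rewrite prodrXr ler_wiXn2l //.
have -> : \bigcup_i G i = \bigcup_(A in Q) \bigcup_(i in A) G i.
  rewrite -(set_partition_big _ QT) /=; apply: eq_bigl => i; by rewrite inE.
elim/big_ind2: _ => //; first by rewrite cards0.
by move=> B a D b Ba Db; apply: leq_trans (leq_card_setU _ _) _; apply: leq_add.
Qed.

(** The families are grouped by their union B. At most (D ^ K') ^ n families have a given union,
    since each member lies inside B. There are 'C(#|C|, d) sets B of size d, of total weight at most
    (#|C| p) ^ d <= Lam ^ D, and d takes D + 1 values. *)
Lemma sum_small_union (K' D n : nat) (Lam : R) :
  (forall B : {set C}, (#|[set j | U j \subset B]| <= #|B| ^ K')%N) ->
  1 <= Lam -> #|C|%:R * p <= Lam ->
  \sum_(F : {ffun 'I_n -> J} | (#|\bigcup_i U (F i)| <= D)%N) p ^+ #|\bigcup_i U (F i)|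
   <= (D.+1 * (D ^ K') ^ n)%:R * Lam ^+ D.
Proof.
move=> UK Lam1 CLam.
rewrite (partition_big (fun F : {ffun _ -> _} => \bigcup_i U (F i))
  (fun B : {set C} => #|B| <= D)%N) //=.
apply: (@le_trans _ _ (\sum_(B : {set C} | (#|B| <= D)%N) ((D ^ K') ^ n)%:R * p ^+ #|B|)).
  apply: ler_sum => B BD.
  under eq_bigr => F /andP[_ /eqP ->] do over.
  rewrite sumr_const -[X in X <= _]mulr_natl ler_wpM2r ?exprn_ge0 // ler_nat.
  apply: (@leq_trans #|ffun_on (mem [set j | U j \subset B]) : {pred {ffun 'I_n -> J}}|).
    apply: subset_leq_card; apply/subsetP => F /andP[_ /eqP FB].
    by apply/ffun_onP => i; rewrite !inE -FB bigcup_sup.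
  rewrite card_ffun_on card_ord leq_wexp2r //.
  apply: leq_trans (UK B) _; exact: leq_wexp2r.
rewrite -big_distrr /= natrM -mulrA [leRHS]mulrCA ler_wpM2l ?ler0n //.
rewrite (partition_big (fun B : {set C} => inord #|B| : 'I_D.+1) predT) //=.
apply: (@le_trans _ _ (\sum_(d < D.+1) Lam ^+ D)); last first.
  by rewrite sumr_const card_ord mulr_natl.
apply: ler_sum => d _.
apply: (@le_trans _ _ (\sum_(B : {set C} | #|B| == d) p ^+ d)).
  rewrite le_eqVlt; apply/orP; left; apply/eqP; apply: eq_big => [B|B /andP[BD /eqP <-]].
    apply/andP/eqP => [[BD /eqP <-]|Bd]; first by rewrite inordK.
    by rewrite Bd -ltnS ltn_ord; split=> //; apply/eqP/val_inj; rewrite /= inordK.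
  by rewrite inordK.
rewrite sumr_const -cardsE card_draws -[X in X <= _]mulr_natl.
apply: (@le_trans _ _ ((#|C|%:R * p) ^+ d)); last first.
  apply: (@le_trans _ _ (Lam ^+ d)); last by apply: ler_weXn2l; rewrite // -ltnS.
  by apply: lerXn2r; rewrite ?nnegrE ?mulr_ge0 // (le_trans ler01).
rewrite exprMn ler_wpM2r ?exprn_ge0 // -natrX ler_nat.
apply: leq_trans (_ : #|C| ^_ d <= _)%N; last first.
  rewrite ffact_prod -[X in (_ <= _ ^ X)%N]card_ord -prod_nat_const.
  by apply: leq_prod => i _; apply: leq_subr.
by rewrite -bin_ffact leq_pmulr ?fact_gt0.
Qed.

Lemma bern_cumulant_le (K K' n : nat) (Lam : R) :
  (forall j, #|U j| <= K.+1)%N ->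
  (forall B : {set C}, (#|[set j | U j \subset B]| <= #|B| ^ K')%N) ->
  1 <= Lam -> #|C|%:R * p <= Lam ->
  let D := (n * K + 1)%N in
  `|bern_cumulant n| <= cumulant_const n * (D.+1 * (D ^ K') ^ n)%:R * Lam ^+ D.
Proof.
move=> UK UK' Lam1 CLam; cbv zeta; set D := (n * K + 1)%N.
rewrite bern_cumulantE (bigID (fun F : {ffun _ -> _} => #|\bigcup_i U (F i)| <= D)%N) /=.
(* A family with more than D cells either splits into two groups with disjoint unions, and its
   cumulant vanishes, or is connected, which contradicts [card_union_connected]. *)
rewrite [X in _ + X]big1 ?addr0; last first.
  move=> F; rewrite -ltnNge => FD.
  have [/existsP[A /and3P[A0 AC0 dA]]|] :=
    boolP [exists A : {set 'I_n}, [&& A != set0, ~: A != set0 &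
     [disjoint \bigcup_(i in A) U (F i) & \bigcup_(i in ~: A) U (F i)]]].
    apply: (@setcum_disconnected _ _ _ A) => [|T||].
    - by rewrite big_set0 cards0.
    - have -> : \bigcup_(i in T) U (F i) =
          (\bigcup_(i in T :&: A) U (F i)) :|: (\bigcup_(i in T :\: A) U (F i)).
        by rewrite -bigcup_setU setID.
      rewrite cardsU -exprD; congr (_ ^+ _).
      suff -> : (\bigcup_(i in T :&: A) U (F i)) :&: (\bigcup_(i in T :\: A) U (F i)) = set0.
        by rewrite cards0 subn0.
      apply/setP => x; rewrite !inE; apply/negP => /andP[/bigcupP[i iTA xi] /bigcupP[j jTA xj]].
      move: iTA jTA; rewrite !inE => /andP[_ iA] /andP[jA _].
      move: dA; rewrite -setI_eq0 => /eqP/setP/(_ x); rewrite !inE => /negP; apply.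
      by apply/andP; split; apply/bigcupP; [exists i|exists j; rewrite ?inE].
    - by rewrite setTI.
    - by rewrite setTD.
  move=> /existsPn conn.
  have := @card_union_connected _ _ (fun i => U (F i)) K (fun i => UK (F i)).
  rewrite card_ord (eq_bigl _ _ (fun i => in_setT i)) leqNgt FD => H.
  exfalso; apply: notF; apply: H => A A0 AC0; have := conn A.
  by rewrite A0 AC0.
apply: le_trans (ler_norm_sum _ _ _) _.
rewrite -mulrA.
apply: (@le_trans _ _ (cumulant_const n *
  \sum_(F : {ffun 'I_n -> J} | (#|\bigcup_i U (F i)| <= D)%N) p ^+ #|\bigcup_i U (F i)|)).
  by rewrite big_distrr /=; apply: ler_sum => F _; apply: norm_setcum_union.
by apply: ler_wpM2l; [apply: sumr_ge0|apply: sum_small_union].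
Qed.

(** The covariance of two indicators is p ^ |union| * (1 - p ^ |intersection|), hence nonnegative,
    and all pairs outside [pairs] may be dropped. Two sets that meet have at most 2K + 1 points in
    their union and at least one in common. *)
Lemma bern_variance_ge (K : nat) (pairs : {set J * J}) :
  (forall j, #|U j| <= K.+1)%N ->
  (forall u, u \in pairs -> ~~ [disjoint U u.1 & U u.2]) ->
  #|pairs|%:R * (p ^+ (2 * K).+1 * (1 - p)) <= bern_cumulant 2.
Proof.
move=> UK pairsI.
have IE : [set: 'I_2] = [set ord0; ord_max].
  by apply/setP => i; rewrite !inE; case: i => -[|[|]].
have mom1 : bern_moment 1 = \sum_j p ^+ #|U j|.
  rewrite /bern_moment; under eq_bigr do rewrite expr1 big_distrr /=.
  by rewrite exchange_big /=; apply: eq_bigr => j _; rewrite bern_weight_superset.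
have mom2 : bern_moment 2 = \sum_(u : J * J) p ^+ #|U u.1 :|: U u.2|.
  rewrite /bern_moment -(pair_bigA _ (fun i j => p ^+ #|U i :|: U j|)) /=.
  under eq_bigr do rewrite expr2 big_distrlr /= big_distrr /=.
  rewrite exchange_big /=; apply: eq_bigr => i _.
  under eq_bigr do rewrite big_distrr /=.
  rewrite exchange_big /=; apply: eq_bigr => j _.
  rewrite -bern_weight_superset; apply: eq_bigr => S _.
  by rewrite subUset -mulnb natrM.
rewrite /bern_cumulant IE setcum2 ?cards0 //; last first.
  rewrite /bern_moment; under eq_bigr do rewrite expr0 mulr1.
  have := bern_weight_superset set0; rewrite cards0 expr0 => <-.
  by apply: eq_bigr => S _; rewrite sub0set mulr1.
rewrite !cards1 cards2 /= mom1 mom2 big_distrlr /= pair_bigA /= -sumrB.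
have termE (u : J * J) : p ^+ #|U u.1 :|: U u.2| - p ^+ #|U u.1| * p ^+ #|U u.2| =
    p ^+ #|U u.1 :|: U u.2| * (1 - p ^+ #|U u.1 :&: U u.2|).
  by rewrite mulrBr mulr1 -!exprD cardsUI.
rewrite (bigID (mem pairs)) /= -[X in X <= _]addr0 lerD //; last first.
  apply: sumr_ge0 => u _; rewrite termE mulr_ge0 ?exprn_ge0 // subr_ge0.
  by rewrite exprn_ile1.
rewrite mulr_natl -sumr_const; apply: ler_sum => u /pairsI.
rewrite -setI_eq0 -card_gt0 termE => UI.
apply: ler_pM; rewrite ?exprn_ge0 ?subr_ge0 //.
  apply: ler_wiXn2l => //; have := cardsUI (U u.1) (U u.2).
  have := UK u.1; have := UK u.2; lia.
by rewrite lerD2l lerN2 -[X in _ <= X]expr1; apply: ler_wiXn2l.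
Qed.

End Family.

(** The size of S counts the singletons inside S, so [sum_small_union] applies to the family of
    singletons, with K' = 1. This bound later yields the integrability of the dominating
    function. *)
Lemma bern_card_moment_le (m : nat) (Lam : R) :
  1 <= Lam -> #|C|%:R * p <= Lam ->
  \sum_S bern_weight S * #|S|%:R ^+ m <= (m.+1 * m ^ m)%:R * Lam ^+ m.
Proof.
move=> Lam1 CLam.
have -> : \sum_S bern_weight S * #|S|%:R ^+ m = bern_moment set1 m.
  apply: eq_bigr => S _; congr (_ * _ ^+ m); rewrite -sumr_const.
  by under [RHS]eq_bigr do rewrite sub1set; rewrite big_mkcond; apply: eq_bigr => i _; case: ifP.
rewrite bern_momentE.
have Um (F : {ffun 'I_m -> C}) : (#|\bigcup_i [set F i]| <= m)%N.
  rewrite -[X in (_ <= X)%N]card_ord -[X in (_ <= X)%N]sum1_card.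
  elim/big_ind2: _ => //; first by rewrite cards0.
    by move=> B a D b Ba Db; apply: leq_trans (leq_card_setU _ _) _; apply: leq_add.
  by move=> i _; rewrite cards1.
rewrite (eq_bigl (fun F : {ffun 'I_m -> C} => #|\bigcup_i [set F i]| <= m)%N);
  last by move=> F; rewrite Um.
rewrite -[X in (_ * X ^ _)%N]expn1; apply: sum_small_union => // B.
by rewrite expn1 (_ : [set j | _] = B) //; apply/setP => x; rewrite inE sub1set.
Qed.

End Bernoulli.

(** * Admissible tuples of cells *)

Section GridHops.
Variables (R : realFieldType) (r h : R) (K N : nat).

(* Cell i is numbered i + 1, so that 0 stands for the origin and N + 1 for the
   point t; then j - (i + 1) cells lie strictly between i and j. *)
Definition grid_hop (i j : nat) : bool :=
  (i < j)%N && ((j - i.+1)%:R * h <= r).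

Definition grid_path (c : K.+1.-tuple 'I_N) : bool :=
  path grid_hop 0%N (rcons [seq (val i).+1 | i <- c] N.+1).

Definition grid_cells (c : {c : K.+1.-tuple 'I_N | grid_path c}) : {set 'I_N} :=
  [set i in val c].

Lemma card_grid_cells c : (#|grid_cells c| <= K.+1)%N.
Proof. by rewrite cardsE (leq_trans (card_size _)) ?size_tuple. Qed.

Lemma card_grid_paths_in (B : {set 'I_N}) :
  (#|[set c | grid_cells c \subset B]| <= #|B| ^ K.+1)%N.
Proof.
pose f (c : {c | grid_path c}) := [ffun i => tnth (val c) i].
have f_inj : injective f.
  move=> c d /ffunP fcd; apply/val_inj/eq_from_tnth => i.
  by have := fcd i; rewrite !ffunE.
rewrite -(card_imset _ f_inj) -[X in (_ <= _ ^ X)%N]card_ord -card_ffun_on.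
apply: subset_leq_card; apply/subsetP => y /imsetP[c + ->{y}]; rewrite inE => /subsetP cB.
by apply/ffun_onP => i; rewrite ffunE cB // inE mem_tnth.
Qed.

End GridHops.

(* The i-th entry of a tuple ranges over the M cells that follow (i + 1) t / k. *)
Section Windows.
Variables (R : realFieldType) (r h : R) (K s M : nat).
Hypotheses (h0 : 0 <= h) (s_gt0 : (0 < s)%N) (M_gt0 : (0 < M)%N).
Hypothesis window_gap : (s.+1 * M)%:R * h <= r.

Let N := (K.+2 * s * M)%N.
Local Notation grid_paths := {c : K.+1.-tuple 'I_N | grid_path r h c}.

Lemma window_cell_lt (i : 'I_K.+1) (a : 'I_M) : (i.+1 * s * M + a < N)%N.
Proof.
apply: (@leq_trans (i.+2 * s * M)); last by rewrite !leq_mul2r ltnS ltn_ord !orbT.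
have -> : (i.+2 * s * M = i.+1 * s * M + s * M)%N by rewrite -!mulnA mulSn addnC.
by rewrite ltn_add2l (leq_trans (ltn_ord a)) ?leq_pmull.
Qed.

Definition window_cell i a : 'I_N := Ordinal (window_cell_lt i a).

Definition window_tuple (b : K.+1.-tuple 'I_M) : K.+1.-tuple 'I_N :=
  [tuple window_cell i (tnth b i) | i < K.+1].

(** In the numbering of [grid_hop], the i-th vertex lies between i s M and i s M + M, the end
    vertices 0 and N + 1 included. Consecutive vertices increase because s >= 1, and fewer than (s +
    1) M cells lie strictly between them. *)
Lemma window_tuple_path b : grid_path r h (window_tuple b).
Proof.
set p := rcons [seq (val i).+1 | i <- window_tuple b] N.+1.
have sp : size p = K.+2 by rewrite size_rcons size_map size_tuple.
have pE i : (i < K.+2)%N -> (i.+1 * s * M < nth 0 p i <= i.+1 * s * M + M)%N.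
  rewrite ltnS leq_eqVlt => /orP[/eqP ->|iK].
    by rewrite nth_rcons size_map size_tuple ltnn eqxx ltnSn /= -addn1 leq_add2l.
  rewrite nth_rcons size_map size_tuple iK.
  rewrite (nth_map (window_cell (Ordinal iK) (tnth b (Ordinal iK)))) ?size_tuple //.
  rewrite -(tnth_nth _ _ (Ordinal iK)) tnth_mktuple /= ltnS leq_addr /=.
  by rewrite -addnS leq_add2l.
apply/(pathP 0%N); rewrite -/p sp => i iK.
(* The lower bound is weak here because the starting vertex 0 attains it. *)
have qE : (i * s * M <= nth 0 (0 :: p) i <= i * s * M + M)%N.
  by case: i iK => [//|i] iK; have /andP[/ltnW -> ->] := pE i (ltnW iK).
have := pE i iK; rewrite /= in qE *; move: (nth 0 (0 :: p) i) (nth 0 p i) qE => x y qE yE.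
have sM : (M <= s * M)%N by rewrite leq_pmull.
have iE : (i.+1 * s * M = s * M + i * s * M)%N by rewrite -mulnA mulSn mulnA.
apply/andP; split; first lia.
apply: le_trans window_gap; rewrite ler_wpM2r // ler_nat mulSn; lia.
Qed.

Definition window_path b : grid_paths := Sub (window_tuple b) (window_tuple_path b).

Lemma window_path_inj : injective window_path.
Proof.
move=> b b' /(congr1 val) /= bb'; apply: eq_from_tnth => i.
have := congr1 (fun c => val (tnth c i)) bb'; rewrite !tnth_mktuple /=.
by move/addnI/val_inj.
Qed.

(** A common first cell and two free tails of K cells give M * M ^ K * M ^ K pairs. *)
Lemma window_path_pairs :
  exists2 pairs : {set grid_paths * grid_paths},
    #|pairs| = (M ^ (2 * K).+1)%N &
    forall u, u \in pairs -> ~~ [disjoint grid_cells u.1 & grid_cells u.2].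
Proof.
pose f (x : 'I_M * K.-tuple 'I_M * K.-tuple 'I_M) :=
  (window_path [tuple of x.1.1 :: x.1.2], window_path [tuple of x.1.1 :: x.2]).
have f_inj : injective f.
  move=> [[a b] b'] [[c d] d'] E.
  have /window_path_inj/(congr1 val)[-> bd] := congr1 fst E.
  have /window_path_inj/(congr1 val)[_ bd'] := congr1 snd E.
  by rewrite (val_inj bd) (val_inj bd').
exists (f @: setT).
  rewrite card_imset // cardsT !card_prod card_ord !card_tuple card_ord.
  by rewrite -expnS -expnD; congr (_ ^ _)%N; lia.
move=> u /imsetP[[[a b] b'] _ ->{u}]; rewrite -setI_eq0; apply/set0Pn.
exists (window_cell ord0 a); rewrite !inE.
apply/andP; split; apply/tnthP; exists ord0; by rewrite tnth_mktuple.
Qed.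

End Windows.

From mathcomp Require Import finmap.
From mathcomp Require Import all_classical all_reals all_analysis.
From mathcomp Require Import measurable_realfun.

Import numFieldNormedType.Exports.

(** * From points to cells *)

Lemma count_inE (R : realType) (B : set R) (X : {fset R}) :
  count_in B X = #|[pred x : X | val x \in B]|.
Proof.
rewrite /count_in (_ : [fset x in X | x \in B]%fset =
  [fset val x | x in [pred x : X | val x \in B]]%fset).
  by rewrite card_imfset /= -?cardE //; apply: val_inj.
apply/fsetP => x; rewrite !inE /=; apply/andP/imfsetP => [[xX xB]|[y yB ->]].
  by exists [` xX]%fset; rewrite //= inE.
by rewrite /= inE in yB; split; [exact: (fsvalP y)|exact/mem_set].
Qed.

Lemma count_in_gt0P (R : realType) (B : set R) (X : {fset R}) :
  reflect (exists2 x, x \in X & B x) (0 < count_in B X)%N.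
Proof.
rewrite count_inE; apply: (iffP card_gt0P) => [[x]|[x xX Bx]].
  by rewrite inE => Bx; exists (val x) => //; apply: fsvalP.
by exists [` xX]%fset; rewrite inE.
Qed.

Lemma path_lt_inside (R : realType) (t a : R) (l : seq R) :
  path <%R a (rcons l t) -> (a < t) && all (fun x => a < x < t) l.
Proof.
elim: l a => [|x l IHl] a /=; first by rewrite !andbT.
move=> /andP[ax /IHl/andP[xt /allP lP]]; rewrite (lt_trans ax xt) ax xt /=.
by apply/allP => y /lP/andP[xy ->]; rewrite (lt_trans ax xy).
Qed.

Lemma map_preim_seq (S T : eqType) (f : S -> T) (P : pred S) (c : seq T) :
  (forall y, y \in c -> exists2 x, P x & f x = y) ->
  exists2 s, all P s & map f s = c.
Proof.
elim: c => [|y c IHc] cP; first by exists [::].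
have [|s sP <-] := IHc; first by move=> z zc; apply: cP; rewrite inE zc orbT.
have [|x xP <-] := cP y; first exact: mem_head.
by exists (x :: s); rewrite //= xP.
Qed.

Section Discretisation.
Variables (R : realType) (r t h : R) (N : nat).
Hypotheses (h_gt0 : 0 < h) (Nh : N%:R * h = t) (N_gt0 : (0 < N)%N).

(* Intersecting with (0, t) removes the point 0, which lies in the cell [0, h). *)
Definition cell (i : nat) : set R :=
  fun x => [&& 0 < x, x < t, i%:R * h <= x & x < i.+1%:R * h].

Definition occupied (X : {fset R}) : {set 'I_N} :=
  finset (fun i : 'I_N => (0 < count_in (cell i) X)%N).

Let slot (x : R) : nat := Num.truncn (x / h).

Let slot_itv x : 0 <= x -> (slot x)%:R * h <= x < (slot x).+1%:R * h.
Proof.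
by move=> x0; rewrite -ler_pdivlMr // -ltr_pdivrMr // truncn_itv // divr_ge0 // ltW.
Qed.

Let cell_slot i x : cell i x -> slot x = i.
Proof.
move=> /and4P[_ _ ix xi]; apply: truncn_def.
by rewrite ler_pdivlMr // ltr_pdivrMr // ix.
Qed.

Let slot_cell x : 0 < x < t -> cell (slot x) x.
Proof.
by move=> /andP[x0 xt]; rewrite /cell x0 xt /=; apply/slot_itv/ltW.
Qed.

Let slot_lt x : 0 < x < t -> (slot x < N)%N.
Proof.
move=> /andP[x0 xt]; have /andP[xl _] := slot_itv (ltW x0).
by rewrite -(ltr_nat R) -(ltr_pM2r h_gt0) Nh (le_lt_trans xl).
Qed.

(** The remainder makes the index total; for x in (0, t) the slot is already below N. *)
Let ord (x : R) : 'I_N := Ordinal (ltn_pmod (slot x) N_gt0).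

Let val_ord x : 0 < x < t -> ord x = slot x :> nat.
Proof. by move=> /slot_lt xN; rewrite /= modn_small. Qed.

Local Notation inside X := [pred x : X | 0 < val x < t].

Local Notation count_span X := (count_in `]0, t[%classic X).

Let count_inside X : count_span X = #|inside X|.
Proof.
rewrite count_inE; apply: eq_card => x; rewrite !inE; apply/idP/idP.
  by move/set_mem; rewrite /= in_itv.
by move=> xt; apply/mem_set; rewrite /= in_itv.
Qed.

Let occupiedE X : occupied X = [set ord (val x) | x in inside X]%SET.
Proof.
apply/setP => i; rewrite inE; apply/count_in_gt0P/imsetP => [[x xX xi]|[x xt ->]].
  have xt : 0 < x < t by case/and4P: xi => -> ->.
  exists [` xX]%fset; rewrite //=.
  by apply: val_inj; rewrite [RHS](val_ord xt) (cell_slot xi).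
exists (val x); first exact: fsvalP.
by rewrite val_ord //; apply: slot_cell.
Qed.

Lemma card_occupied_le X : (#|occupied X| <= count_span X)%N.
Proof. by rewrite count_inside occupiedE leq_imset_card. Qed.

(** The first condition puts distinct points into distinct cells. The second leaves a margin of 2h
    above r: an allowed cell hop only guarantees a distance below r + 2h, which then must be at most
    r. The points 0 and t are included because hops start and end there. *)
Definition hop_separated (X : {fset R}) : Prop :=
  forall x y, x \in [:: 0, t & X] -> y \in [:: 0, t & X] ->
    (x < y -> h < y - x) /\ (r < y - x -> r + 2 * h <= y - x).

Let ord_inj X : hop_separated X -> {in inside X &, injective (fun x => ord (val x))}.
Proof.
move=> sepX x y xt yt /(congr1 val) xy; apply/val_inj.
have {}xy : slot (val x) = slot (val y) by rewrite -!val_ord.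
have inX (z : X) : val z \in [:: 0, t & X] by rewrite !inE (fsvalP z) !orbT.
have /andP[x0 _] := xt; have /andP[y0 _] := yt.
have := slot_itv (ltW x0); have := slot_itv (ltW y0); rewrite xy -natr1 mulrDl mul1r.
have [H1 _] := sepX _ _ (inX x) (inX y); have [H2 _] := sepX _ _ (inX y) (inX x).
move=> /andP[a1 a2] /andP[b1 b2]; case: (ltgtP (val x) (val y)) => // /[dup].
  by move=> /H1; lra.
by move=> /H2; lra.
Qed.

Lemma card_occupied X : hop_separated X -> #|occupied X| = count_span X.
Proof. by move=> sepX; rewrite count_inside occupiedE card_in_imset //; apply: ord_inj. Qed.

(** The numbering of [grid_hop] read on points: 0 for the origin, and N + 1 for t, whose slot is
    N. *)
Let phi (x : R) : nat := if x <= 0 then 0%N else (slot x).+1.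

Let hop_phi X x y : hop_separated X -> x \in [:: 0, t & X] -> y \in [:: 0, t & X] ->
  0 <= x -> 0 < y -> hop r x y = grid_hop r h (phi x) (phi y).
Proof.
move=> sepX xX yX x0 y0; have [xy_h xy_r] := sepX x y xX yX.
have /andP[yl yu] := slot_itv (ltW y0).
have phiy : phi y = (slot y).+1 by rewrite /phi leNgt y0.
have [xl xu] : x <= (phi x)%:R * h /\ (phi x)%:R * h <= x + h.
  rewrite /phi; case: ifP => [x0'|_].
    by rewrite mul0r; have -> : x = 0 by [apply/eqP; rewrite eq_le x0'|]; lra.
  have := slot_itv x0; rewrite -natr1 mulrDl mul1r; lra.
rewrite /hop /grid_hop phiy subSS; rewrite -natr1 mulrDl mul1r in yu.
apply/andP/andP => [[xy yxr]|[]].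
  have xy' : (phi x <= slot y)%N.
    rewrite -ltnS -(ltr_nat R) -(ltr_pM2r h_gt0) -natr1 mulrDl mul1r.
    by have := xy_h xy; lra.
  by split=> //; rewrite natrB // mulrBl; lra.
rewrite ltnS => xy'; rewrite natrB // mulrBl => yxr.
have {}xy : x < y.
  have le_xy : x <= y.
    by apply: le_trans xl _; apply: le_trans yl; rewrite ler_pM2r // ler_nat.
  rewrite lt_neqAle le_xy andbT; apply: contraTneq xy' => ->.
  by rewrite phiy ltnn.
by split=> //; rewrite leNgt; apply/negP => /xy_r; lra.
Qed.

Let hop_phi0 X x y : hop_separated X -> x \in [:: 0, t & X] -> y \in [:: 0, t & X] ->
  0 <= x -> 0 <= y -> hop r x y = grid_hop r h (phi x) (phi y).
Proof.
move=> sepX xX yX x0; rewrite le_eqVlt => /orP[/eqP <-|y0]; last exact: (@hop_phi X).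
by rewrite /hop /grid_hop ltNge x0 /phi lexx ltn0.
Qed.

Let path_phi (X : {fset R}) (s : seq X) : 0 < t -> hop_separated X -> all (mem (inside X)) s ->
  path (hop r) 0 (rcons (map val s) t) =
  path (grid_hop r h) 0%N
    (rcons [seq (val i).+1 | i <- map (fun x : X => ord (val x)) s] N.+1).
Proof.
move=> t_gt0 sepX sX.
have -> : rcons [seq (val i).+1 | i <- map (fun x : X => ord (val x)) s] N.+1 =
    map phi (rcons (map val s) t).
  rewrite map_rcons -!map_comp; congr rcons; last first.
    by rewrite /phi leNgt t_gt0 /slot -Nh mulfK ?gt_eqF // natrK.
  apply/eq_in_map => x /(allP sX) xt.
  rewrite /comp /phi leNgt; case/andP: (xt) => -> _ /=; congr _.+1.
  exact: val_ord.
have -> : 0%N = phi 0 by rewrite /phi lexx.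
rewrite path_map; pose P := [pred x | (x \in [:: 0, t & X]) && (0 <= x)].
apply: (@eq_in_path _ P) => [x y /andP[xX x0] /andP[yX y0]|].
  exact: (@hop_phi0 X).
rewrite /= inE eqxx lexx all_rcons /= !inE eqxx orbT ltW //= all_map.
apply/allP => x /(allP sX) /= /andP[x0 _]; rewrite !inE (ltW x0) andbT.
by rewrite (fsvalP x) !orbT.
Qed.

(** Sending each point to its cell is a bijection from hop paths to grid paths with all cells
    occupied: injective since a cell holds at most one point, surjective since an occupied cell
    holds one, and compatible with hops by [path_phi]. *)
Lemma num_hops_grid (K : nat) (X : {fset R}) : 0 < t -> hop_separated X ->
  \sum_(c : {c : K.+1.-tuple 'I_N | grid_path r h c})
     (grid_cells c \subset occupied X)%:R = (num_hops r K.+2 t X)%:R :> R.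
Proof.
move=> t_gt0 sepX; rewrite -natr_sum; congr (_%:R).
rewrite /num_hops /= -big_mkcond /= sum1_card -cardsE -[RHS]cardsE.
pose f (s : K.+1.-tuple X) : K.+1.-tuple 'I_N := map_tuple (fun x : X => ord (val x)) s.
have insideP (s : K.+1.-tuple X) : path (hop r) 0 (rcons (map val s) t) ->
    all (mem (inside X)) s.
  move=> sp; have : path <%R 0 (rcons (map val s) t).
    by apply: sub_path sp => x y /andP[].
  by move/path_lt_inside/andP => [_]; rewrite all_map.
rewrite -(card_imset _ val_inj) -[RHS](card_in_imset (f := f)); last first.
  move=> s s'; rewrite !inE => /insideP/allP sX /insideP/allP s'X fss'.
  apply: eq_from_tnth => i; apply: (ord_inj sepX); [exact/sX/mem_tnth|exact/s'X/mem_tnth|].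
  by have := congr1 (fun c => tnth c i) fss'; rewrite !tnth_map.
apply: eq_card => c; apply/imsetP/imsetP => [[d dX ->]|[s]].
  have {}dX : grid_cells d \subset occupied X by move: dX; rewrite !inE.
  have [|s sX sd] := @map_preim_seq X _ (fun x => ord (val x)) (inside X) (val d).
    move=> i id_; have : i \in occupied X by apply: (fintype.subsetP dX); rewrite inE.
    by rewrite occupiedE => /imsetP[x xX ->]; exists x.
  have ss : size s == K.+1 by rewrite -(size_map (fun x : X => ord (val x))) sd size_tuple.
  exists (Tuple ss); last by apply/val_inj; rewrite /= sd.
  rewrite !inE /= path_phi // sd; exact: (valP d).
rewrite !inE => sp ->; have sX := insideP _ sp.
have fp : grid_path r h (f s) by rewrite /grid_path /= -path_phi.
exists (Sub (f s) fp) => //; rewrite !inE; apply/fintype.subsetP => i; rewrite inE /=.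
by move=> /mapP[x /(allP sX) xX ->]; rewrite occupiedE; apply: imset_f.
Qed.

End Discretisation.

Local Open Scope classical_set_scope.
Local Open Scope ring_scope.

(** * Occupied cells of a Poisson process *)

Lemma uniform_small (R : realFieldType) (S : eqType) (l : seq S) (P : S -> R -> Prop) :
  (forall x, exists2 e, 0 < e & forall h, h < e -> P x h) ->
  exists2 e, 0 < e & forall h, h < e -> forall x, x \in l -> P x h.
Proof.
move=> small; elim: l => [|x l [e e0 IHe]]; first by exists 1.
have [e' e'0 xe'] := small x; exists (Num.min e e'); first by rewrite lt_min e0.
move=> h; rewrite lt_min => /andP[he he'] y.
by rewrite inE => /orP[/eqP ->|yl]; [apply: xe'|apply: IHe].
Qed.

Lemma separated_small (R : realType) (r t : R) (X : {fset R}) :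
  exists2 e, 0 < e & forall h, h < e -> hop_separated r t h X.
Proof.
pose Z : seq R := [:: 0, t & X].
have [|e e0 eP] := @uniform_small R (R * R)%type [seq (x, y) | x <- Z, y <- Z]
  (fun u h => (u.1 < u.2 -> h < u.2 - u.1) /\ (r < u.2 - u.1 -> r + 2 * h <= u.2 - u.1)).
  move=> [x y] /=.
  (* Each pair of points gives one threshold per implication; the value 1 stands in when the premise
     fails. *)
  exists (Num.min (if x < y then y - x else 1) (if r < y - x then (y - x - r) / 2 else 1)).
    by rewrite lt_min; apply/andP; split; case: ifP => // H; lra.
  by move=> h; rewrite lt_min => /andP[h1 h2]; split=> H; rewrite H in h1 h2 *; lra.
exists e => // h he x y xZ yZ; apply: (eP h he (x, y)).
by apply/allpairsP; exists (x, y).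
Qed.

Lemma poisson_prob_set0 (R : realType) (q : R) : 0 < q ->
  poisson_prob q 0%N [set 0%N] = (expR (- q))%:E.
Proof.
move=> q0; rewrite /poisson_prob q0 esum_set1 ?lee_fin ?poisson_pmf_ge0 //.
by rewrite /poisson_pmf q0 expr0 fact0 invr1 !mul1r.
Qed.

Lemma poisson_prob_pos (R : realType) (q : R) : 0 < q ->
  poisson_prob q 0%N [set n | (0 < n)%N] = (1 - expR (- q))%:E.
Proof.
move=> q0; have -> : [set n | (0 < n)%N] = ~` [set 0%N].
  by apply/seteqP; split => -[|n] //= /(_ erefl).
by rewrite probability_setC //= poisson_prob_set0 // EFinB.
Qed.


Section Occupied.
Variables (R : realType) (d : measure_display) (T : measurableType d).
Variables (P : probability T R) (L lam : R) (X : T -> {fset R}).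
Hypothesis PX : poisson_process P L lam X.
Variables (t h : R) (N : nat).
Hypotheses (lam_gt0 : 0 < lam) (h_gt0 : 0 < h) (Nh : N%:R * h = t) (tL : t <= L).

Let cell_itv (i : 'I_N) :
  cell t h i = [set` if i == 0 :> nat then `]0, h[ else `[i%:R * h, i.+1%:R * h[].
Proof.
have iN : i.+1%:R * h <= t by rewrite -Nh ler_wpM2r ?ler_nat // ltW.
apply/seteqP; split => x; rewrite /cell.
  move=> /and4P[x0 xt xl xu]; case: eqP => [i0|_]; rewrite /= in_itv /= ?x0 ?xl //.
  by rewrite i0 mul1r in xu.
case: eqP => [i0|/eqP i0]; rewrite /= in_itv /= => /andP[xl xu].
  by rewrite i0 mul0r mul1r in iN *; rewrite xl ltW //= xu andbT (lt_le_trans xu).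
rewrite xl xu (lt_le_trans xu) //= !andbT; apply: lt_le_trans xl.
by rewrite mulr_gt0 // ltr0n lt0n.
Qed.

Let measurable_cell (i : 'I_N) : measurable (cell t h i).
Proof. by rewrite cell_itv; case: eqP. Qed.

Let cell_sub (i : 'I_N) : cell t h i `<=` `[0, L].
Proof.
move=> x /and4P[x0 xt _ _]; rewrite /= in_itv /= ltW //=.
by rewrite (le_trans _ tL) // ltW.
Qed.

Let lebesgue_cell (i : 'I_N) : fine (lebesgue_measure (cell t h i)) = h.
Proof.
rewrite cell_itv; case: eqP => [i0|_]; rewrite lebesgue_measure_itv /= lte_fin.
  by rewrite h_gt0 -EFinB /= subr0.
by rewrite ltr_pM2r // ltr_nat ltnSn -EFinB /= -natr1; lra.
Qed.

Let cell_disjoint : trivIset [set: 'I_N] (fun i : 'I_N => cell t h i).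
Proof.
have le_cell (i j : 'I_N) x : cell t h i x -> cell t h j x -> (i <= j)%N.
  move=> /and4P[_ _ xi _] /and4P[_ _ _ xj]; rewrite -ltnS -(ltr_nat R).
  by rewrite -(ltr_pM2r h_gt0) (le_lt_trans xi xj).
move=> i j _ _ [x [xi xj]]; apply: val_inj; apply/eqP.
by rewrite eqn_leq (le_cell _ _ _ xi xj) (le_cell _ _ _ xj xi).
Qed.

Definition cell_prob : R := 1 - expR (- (lam * h)).

Lemma cell_prob01 : 0 <= cell_prob <= 1.
Proof.
rewrite /cell_prob gerBl expR_ge0 subr_ge0 andbT -[leRHS]expR0 ler_expR.
by rewrite oppr_le0 mulr_ge0 ?ltW.
Qed.

Let occ w := occupied t h N (X w).

Let U (S : {set 'I_N}) (i : 'I_N) : set nat :=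
  if i \in S then [set n | (0 < n)%N] else [set 0%N].

(** The event takes the form required by the independence clause: one condition on the count of each
    of the disjoint cells. *)
Let occ_eventE S : [set w | occ w = S] =
  [set w | forall i : 'I_N, U S i (count_in (cell t h i) (X w))].
Proof.
apply/seteqP; split => w /=.
  by move=> <- i; rewrite /U /occ inE; case: posnP => /=.
move=> wS; apply/setP => i; rewrite inE; have := wS i; rewrite /U.
by case: ifP => _ /= => [->|->].
Qed.

Lemma measurable_occupied S : measurable [set w | occ w = S].
Proof.
have [_ mX _ _] := PX.
rewrite occ_eventE (_ : [set w | _] = \bigcap_(i in [set: 'I_N])
  ((fun w => count_in (cell t h i) (X w)) @^-1` U S i)); last first.
  by apply/seteqP; split => w /= wU i; [move=> _; apply: wU|apply: wU].
apply: fin_bigcap_measurable => // i _; rewrite -[X in measurable X]setTI.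
by apply: mX.
Qed.

Lemma prob_occupied S :
  P [set w | occ w = S] = (bern_weight cell_prob S)%:E.
Proof.
have [_ _ lawX indepX] := PX.
rewrite occ_eventE indepX //.
under eq_bigr => i _ do rewrite lawX // lebesgue_cell.
have lamh : 0 < lam * h by rewrite mulr_gt0.
under eq_bigr => i _.
  rewrite (_ : poisson_prob _ _ _ = (if i \in S then cell_prob else 1 - cell_prob)%:E); last first.
    rewrite /U; case: ifP => _; first exact: poisson_prob_pos.
    by rewrite poisson_prob_set0 // /cell_prob subKr.
  over.
rewrite prodEFin /bern_weight -!prodr_const (bigID (mem S)) /=; congr (_ * _)%:E.
  by apply: eq_bigr => i ->.
by apply: eq_big => i; rewrite ?inE // => /negbTE ->.
Qed.

Section Functional.
Variable g : {set 'I_N} -> R.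

(** The occupied set takes finitely many values, so any function of it is a simple function. *)
Let indic_sum w : g (occ w) = \sum_S g S * \1_[set w | occ w = S] w.
Proof.
rewrite (bigD1 (occ w)) //= big1 ?addr0 => [|S So].
  by rewrite indicE mem_set // mulr1.
by rewrite indicE memNset ?mulr0 //= => /esym/eqP; apply/negP.
Qed.

Lemma measurable_fun_occupied : measurable_fun [set: T] (fun w => g (occ w)).
Proof.
rewrite (_ : (fun w => _) = fun w => \sum_S g S * \1_[set w | occ w = S] w); last first.
  by apply/funext => w; apply: indic_sum.
apply: measurable_sum => S; apply: measurable_funM => //.
by apply: measurable_indic; apply: measurable_occupied.
Qed.

Lemma integral_occupied : (forall S, 0 <= g S) ->
  (\int[P]_w (g (occ w))%:E = (\sum_S bern_weight cell_prob S * g S)%:E)%E.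
Proof.
move=> g0; under eq_integral do rewrite indic_sum -sumEFin.
rewrite ge0_integral_sum //=.
- rewrite -sumEFin; apply: eq_bigr => S _.
  under eq_integral do rewrite EFinM.
  rewrite ge0_integralZl //=; last 2 first.
  + apply/measurable_EFinP/measurable_indic; exact: measurable_occupied.
  + by rewrite lee_fin.
  rewrite integral_indic ?setIT; last exact: measurable_occupied.
  rewrite mulrC EFinM; congr (_ * _)%E; exact: prob_occupied.
- exact: measurableT.
- move=> S; apply/measurable_EFinP; apply: measurable_funM => //.
  by apply: measurable_indic; apply: measurable_occupied.
- by move=> S w _; rewrite lee_fin mulr_ge0.
Qed.

End Functional.

End Occupied.

(** * Refining the mesh *)

Lemma limn_einf_le (R : realType) (u : (\bar R)^nat) (B : \bar R) :
  (forall n, (u n <= B)%E) -> (limn_einf u <= B)%E.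
Proof.
move=> uB; rewrite limn_einf_lim; apply: lime_le; first exact: is_cvg_einfs.
apply: nearW => n; apply: le_trans (uB n); apply: ereal_inf_lbound.
by exists n => /=.
Qed.

Section Mesh.
Variables (R : realType) (r t : R) (K s : nat).
Hypotheses (t_gt0 : 0 < t) (s_gt0 : (0 < s)%N).

(** A multiple of k s, so that the windows of width M = m + 1 fit the grid exactly. *)
Definition mesh_size (m : nat) : nat := (K.+2 * s * m.+1)%N.
Definition mesh (m : nat) : R := t / (mesh_size m)%:R.

Lemma mesh_size_gt0 m : (0 < mesh_size m)%N.
Proof. by rewrite !muln_gt0 s_gt0. Qed.

Lemma mesh_gt0 m : 0 < mesh m.
Proof. by rewrite divr_gt0 // ltr0n mesh_size_gt0. Qed.

Lemma mesh_sizeM m : (mesh_size m)%:R * mesh m = t.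
Proof. by rewrite mulrC mulfVK // pnatr_eq0 -lt0n mesh_size_gt0. Qed.

Lemma mesh_small e : 0 < e -> \forall m \near \oo, mesh m < e.
Proof.
move=> e0; exists (Num.truncn (t / e)) => // m /= em.
rewrite /mesh ltr_pdivrMr ?ltr0n ?mesh_size_gt0 // mulrC -ltr_pdivrMr //.
apply: lt_le_trans (truncnS_gt _) _; rewrite ler_nat.
by apply: (@leq_trans m.+1); rewrite // leq_pmull // muln_gt0 s_gt0.
Qed.

Lemma near_hop_separated (X : {fset R}) :
  \forall m \near \oo, hop_separated r t (mesh m) X.
Proof.
have [e e0 eP] := separated_small r t X.
by apply: filterS (mesh_small e0) => m /eP.
Qed.

Definition mesh_hops m (S : {set 'I_(mesh_size m)}) : R :=
  \sum_(c : {c : K.+1.-tuple 'I_(mesh_size m) | grid_path r (mesh m) c})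
    (grid_cells c \subset S)%:R.

Lemma mesh_hops_le m (S : {set 'I_(mesh_size m)}) : mesh_hops S <= #|S|%:R ^+ K.+1 :> R.
Proof.
rewrite /mesh_hops -natr_sum -natrX ler_nat -big_mkcond /= sum1_card -cardsE.
exact: card_grid_paths_in.
Qed.

Lemma mesh_hops_ge0 m (S : {set 'I_(mesh_size m)}) : 0 <= mesh_hops S.
Proof. by apply: sumr_ge0. Qed.

Section Limit.
Variables (d : measure_display) (T : measurableType d) (P : probability T R).
Variables (L lam : R) (X : T -> {fset R}).
Hypothesis PX : poisson_process P L lam X.
Hypotheses (lam_gt0 : 0 < lam) (tL : t <= L).

Local Notation occ m w := (occupied t (mesh m) (mesh_size m) (X w)).
Local Notation p m := (cell_prob lam (mesh m)).

Let count (w : T) : R := (count_in `]0, t[%classic (X w))%:R.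

Let measurable_count : measurable_fun [set: T] count.
Proof.
have [_ mX _ _] := PX.
apply: (measurableT_comp (f := fun n : nat => n%:R : R)) => //.
apply: mX => // x; rewrite /= !in_itv /= => /andP[x0 xt].
by rewrite ltW //= (le_trans (ltW xt)).
Qed.

Lemma mesh_cell_prob_le m : (mesh_size m)%:R * p m <= lam * t.
Proof.
rewrite -[in X in _ <= X](mesh_sizeM m) mulrCA ler_wpM2l ?ler0n // /cell_prob.
by rewrite lerBlDr -lerBlDl; have := expR_ge1Dx (- (lam * mesh m)); lra.
Qed.

(** Fatou's lemma along the meshes: the number of occupied cells is eventually the number of points
    in (0, t), and its moments are bounded uniformly in m because N p <= lam t. *)
Let integrable_count q : P.-integrable [set: T] (fun w => (count w ^+ q)%:E).
Proof.
have mcq : measurable_fun [set: T] (fun w => (count w ^+ q)%:E).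
  by apply/measurable_EFinP/measurable_funX.
apply/integrableP; split=> //.
under eq_integral do rewrite gee0_abs ?lee_fin ?exprn_ge0 ?ler0n //.
have lim_occ w : limn_einf (fun m => (#|occ m w|%:R ^+ q)%:E) = (count w ^+ q)%:E.
  suff : (fun m => (#|occ m w|%:R ^+ q)%:E) @ \oo --> (count w ^+ q)%:E.
    by move=> /cvg_limn_einf_sup[].
  apply: cvg_near_cst; apply: filterS (near_hop_separated (X w)) => m sepX.
  by rewrite (card_occupied (r := r)) ?mesh_gt0 ?mesh_sizeM ?mesh_size_gt0.
under eq_integral do rewrite -lim_occ.
pose Lam := 1 + lam * t.
apply: (@le_lt_trans _ _ ((q.+1 * q ^ q)%:R * Lam ^+ q)%:E); last exact: ltry.
apply: le_trans (fatou _ _ _ _) _ => //.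
  move=> m; apply/measurable_EFinP.
  exact: (measurable_fun_occupied PX (mesh_gt0 m) (mesh_sizeM m) tL (fun S => #|S|%:R ^+ q)).
apply: limn_einf_le => m.
rewrite (integral_occupied PX lam_gt0 (mesh_gt0 m) (mesh_sizeM m) tL
  (g := fun S => #|S|%:R ^+ q)) //.
rewrite lee_fin; apply: bern_card_moment_le.
- by apply: cell_prob01; rewrite ?mesh_gt0.
- by rewrite lerDl mulr_ge0 // ltW.
- by rewrite card_ord (le_trans (mesh_cell_prob_le m)) // lerDr.
Qed.

(** Dominated convergence: for each configuration the discrete count is eventually equal to the hop
    count, and it never exceeds the (K + 1)-st power of the number of points in (0, t). *)
Lemma moment_hops_cvg (q : nat) :
  bern_moment (p m) (@grid_cells R r (mesh m) K (mesh_size m)) q @[m --> \oo] -->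
  fine 'E_P[fun w => (num_hops r K.+2 t (X w))%:R ^+ q].
Proof.
pose f m w := (mesh_hops (occ m w) ^+ q)%:E.
pose f_lim w := ((num_hops r K.+2 t (X w))%:R ^+ q : R)%:E.
have mf m : measurable_fun [set: T] (f m).
  apply/measurable_EFinP.
  exact: (measurable_fun_occupied PX (mesh_gt0 m) (mesh_sizeM m) tL (fun S => mesh_hops S ^+ q)).
have f_cvg w : f ^~ w @ \oo --> f_lim w.
  apply: cvg_near_cst; apply: filterS (near_hop_separated (X w)) => m sepX.
  by rewrite /f /f_lim /mesh_hops num_hops_grid ?mesh_gt0 ?mesh_sizeM ?mesh_size_gt0.
(* Measurability of the hop count comes from its being a pointwise limit of functions of the
   occupied cells. *)
have mf_lim : measurable_fun [set: T] f_lim.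
  by apply: emeasurable_fun_cvg mf _ => w _; apply: f_cvg.
have f_le m w : (`|f m w| <= (count w ^+ (K.+1 * q))%:E)%E.
  rewrite gee0_abs ?lee_fin ?exprn_ge0 ?mesh_hops_ge0 // exprM.
  apply: lerXn2r; rewrite ?nnegrE ?exprn_ge0 ?ler0n ?mesh_hops_ge0 //.
  apply: le_trans (mesh_hops_le _) _; apply: lerXn2r; rewrite ?nnegrE //.
  by rewrite ler_nat; apply: card_occupied_le; rewrite ?mesh_gt0 ?mesh_sizeM ?mesh_size_gt0.
have [int_lim _ int_cvg] := dominated_convergence measurableT mf mf_lim
  (aeW _ (fun w _ => f_cvg w)) (integrable_count (K.+1 * q))
  (aeW _ (fun w m _ => f_le m w)).
have fin_lim := integrable_fin_num measurableT int_lim.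
rewrite unlock -(fineK fin_lim) in int_cvg *.
rewrite /=; move/fine_cvg: int_cvg; apply: cvg_trans.
apply: near_eq_cvg; apply: nearW => m /=.
rewrite (integral_occupied PX lam_gt0 (mesh_gt0 m) (mesh_sizeM m) tL
  (g := fun S => mesh_hops S ^+ q)) //.
by move=> S; rewrite exprn_ge0 // mesh_hops_ge0.
Qed.

End Limit.
End Mesh.

(** * Cumulants of the hop count *)

Lemma cvg_sumr (R : realType) (J : Type) (s : seq J) (Q : pred J)
    (f : J -> nat -> R) (a : J -> R) :
  (forall i, Q i -> f i @ \oo --> a i) ->
  \sum_(i <- s | Q i) f i m @[m --> \oo] --> \sum_(i <- s | Q i) a i.
Proof.
move=> fa; elim: s => [|i s IHs].
  by rewrite big_nil; under eq_fun do rewrite big_nil; exact: cvg_cst.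
rewrite big_cons; under eq_fun do rewrite big_cons.
by case: ifP => // Qi; apply: cvgD => //; apply: fa.
Qed.

Lemma cvg_prodr (R : realType) (J : Type) (s : seq J) (Q : pred J)
    (f : J -> nat -> R) (a : J -> R) :
  (forall i, Q i -> f i @ \oo --> a i) ->
  \prod_(i <- s | Q i) f i m @[m --> \oo] --> \prod_(i <- s | Q i) a i.
Proof.
move=> fa; elim: s => [|i s IHs].
  by rewrite big_nil; under eq_fun do rewrite big_nil; exact: cvg_cst.
rewrite big_cons; under eq_fun do rewrite big_cons.
by case: ifP => // Qi; apply: cvgM => //; apply: fa.
Qed.

(** Exchanging the sums leaves, for each partition, the single index l equal to its number of
    blocks; this lies between 1 and n because the n indices form a nonempty set. *)
Lemma cumulantE (R : realType) (d : measure_display) (T : measurableType d)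
    (P : probability T R) (n : nat) (Y : T -> R) : (0 < n)%N ->
  cumulant P n Y =
  setcum (fun A : {set 'I_n} => fine 'E_P[fun w => Y w ^+ #|A|])
    (finset.setTfor 'I_n).
Proof.
move=> n_gt0; rewrite /cumulant /joint_cumulant /setcum.
under eq_bigr do rewrite big_distrr /=.
rewrite (exchange_big_dep (fun Q => finset.partition Q (finset.setTfor 'I_n))) /=; last first.
  by move=> l Q _ /andP[].
apply: eq_bigr => Q QT.
have Qn : (0 < #|Q| <= n)%N.
  have := card_partition QT; rewrite cardsT card_ord => nQ; apply/andP; split.
    rewrite lt0n; apply: contraTneq n_gt0 => Q0.
    by rewrite nQ big1 // => A AQ; move: (card0_eq Q0 A); rewrite AQ.
  rewrite [X in (_ <= X)%N]nQ -sum1_card; apply: leq_sum => A AQ.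
  by rewrite card_gt0 (partition_neq0 QT AQ).
rewrite (eq_bigl (fun l => l == #|Q|)); last by move=> l; rewrite QT eq_sym.
rewrite big_nat1_eq ltnS Qn /block_coef mulrC [_ * (-1) ^+ _]mulrC mulrC.
congr (_ * _); apply: eq_bigr => A _; congr (fine 'E_P[_]).
by apply/funext => w; rewrite prodr_const.
Qed.

Section HopCumulants.
Variables (R : realType) (r t : R) (K s : nat).
Hypotheses (t_gt0 : 0 < t) (s_gt0 : (0 < s)%N).
Variables (d : measure_display) (T : measurableType d) (P : probability T R).
Variables (L lam : R) (X : T -> {fset R}).
Hypothesis PX : poisson_process P L lam X.
Hypotheses (lam_gt1 : 1 < lam) (tL : t <= L).

Local Notation p m := (cell_prob lam (mesh t K s m)).
Local Notation bcum n m :=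
  (bern_cumulant (p m) (@grid_cells R r (mesh t K s m) K (mesh_size K s m)) n).
Let lam_gt0 : 0 < lam := lt_trans ltr01 lam_gt1.

Lemma bern_cumulant_cvg n : (0 < n)%N ->
  bcum n m @[m --> \oo] --> hop_cumulant P X r K.+2 t n.
Proof.
move=> n_gt0; rewrite /hop_cumulant cumulantE // /bern_cumulant /setcum.
apply: cvg_sumr => Q _; apply: cvgM; first exact: cvg_cst.
apply: cvg_prodr => A _.
exact: (moment_hops_cvg (r := r) (K := K) (q := #|A|) t_gt0 s_gt0 PX lam_gt0 tL).
Qed.

Lemma hop_cumulant_le n : (0 < n)%N ->
  let D := (n * K + 1)%N in
  `|hop_cumulant P X r K.+2 t n| <=
    cumulant_const R n * (D.+1 * (D ^ K.+1) ^ n)%:R * (1 + t) ^+ D * lam ^+ D.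
Proof.
move=> n_gt0; cbv zeta; set D := (n * K + 1)%N.
apply: (cvgr_to_le (F := \oo) (f := fun m => `|bcum n m|)).
  exact: (cvg_norm (bern_cumulant_cvg n_gt0)).
(* The parameter [Lam] is (1 + t) lam: at least 1 as lam > 1, and at least lam t, which bounds N
   p. *)
apply: nearW => m; rewrite -mulrA -exprMn.
apply: bern_cumulant_le.
- by apply: cell_prob01; rewrite ?mesh_gt0.
- by move=> c; apply: card_grid_cells.
- by move=> B; apply: card_grid_paths_in.
- by apply: mulr_ege1; [rewrite lerDl ltW|exact: ltW].
rewrite card_ord; apply: le_trans (mesh_cell_prob_le _ _ _ _ _) _ => //.
by rewrite [lam * t]mulrC ler_wpM2r ?lerDr ?(ltW lam_gt0).
Qed.

(** With M = m + 1 and h = t / (k s M), the M ^ (2K + 1) window pairs each contribute at least (lam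
    h / 2) ^ (2K + 1) / 2. The product M lam h / 2 = lam t / (2 k s) is free of m, so the bound
    survives the limit. The assumption is [window_gap] for this h. *)
Lemma hop_variance_ge : s.+1%:R * t <= (K.+2 * s)%:R * r ->
  (t / (2 * (K.+2 * s)%:R)) ^+ (2 * K).+1 / 2 * lam ^+ (2 * K).+1
    <= hop_cumulant P X r K.+2 t 2.
Proof.
move=> gap; apply: (cvgr_to_ge (F := \oo) (f := fun m => bcum 2 m)); first exact: bern_cumulant_cvg.
have e_gt0 : 0 < (2 * lam)^-1 by rewrite invr_gt0 mulr_gt0.
apply: filterS (mesh_small t K s_gt0 e_gt0) => m; set h := mesh t K s m.
rewrite -[_^-1]mul1r ltr_pdivlMr ?mulr_gt0 // => hs.
have h_gt0 : 0 < h by apply: mesh_gt0.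
have Ks : 0 < (K.+2 * s)%:R :> R by rewrite ltr0n muln_gt0.
have hE : h = t / (K.+2 * s)%:R / m.+1%:R by rewrite /h /mesh /mesh_size natrM invfM mulrA.
have [|pairs pairsE pairsI] := @window_path_pairs R r h K s m.+1 (ltW h_gt0) s_gt0 isT.
  rewrite hE natrM mulrACA mulfV ?pnatr_eq0 // mulr1 mulrA ler_pdivrMr //.
  by rewrite [r * _]mulrC.
have := @bern_variance_ge R _ (p m) (cell_prob01 lam_gt0 h_gt0) _ _ K pairs
  (@card_grid_cells _ _ _ _ _) pairsI.
apply: le_trans; rewrite pairsE.
have q_lt : lam * h <= 1 / 2 by lra.
have q_gt0 : 0 < lam * h by rewrite mulr_gt0.
have p_ge : lam * h / 2 <= p m.
  rewrite /cell_prob -/h; set q := lam * h in q_lt q_gt0 *.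
  have : expR (- q) <= (1 + q)^-1.
    by rewrite expRN lef_pV2 ?posrE ?expR_gt0 ?expR_ge1Dx //; lra.
  (* This amounts to q ^ 2 <= q, true for 0 < q <= 1 / 2. *)
  have : (1 + q)^-1 <= 1 - q / 2.
    rewrite -[X in X <= _]mul1r ler_pdivrMr; nra.
  lra.
have p_le : 1 / 2 <= 1 - p m.
  rewrite /cell_prob -/h subKr; have := expR_ge1Dx (- (lam * h)); lra.
have -> : (t / (2 * (K.+2 * s)%:R)) ^+ (2 * K).+1 / 2 * lam ^+ (2 * K).+1 =
    (m.+1%:R * (lam * h / 2)) ^+ (2 * K).+1 / 2.
  rewrite mulrAC -exprMn; congr (_ ^+ _ / 2); rewrite hE.
  by move: (K.+2 * s)%:R Ks => c c_gt0; field; rewrite nat1r pnatr_eq0 (gt_eqF c_gt0).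
rewrite [in leLHS]exprMn [in leRHS]natrX -[leLHS]mulrA ler_wpM2l ?exprn_ge0 //.
have lamh2 : 0 <= lam * h / 2 by rewrite divr_ge0 // ltW.
apply: ler_pM; rewrite ?exprn_ge0 ?invr_ge0 //; last by rewrite -[leLHS]mul1r.
by apply: lerXn2r; rewrite ?nnegrE ?(le_trans lamh2).
Qed.

End HopCumulants.

(** The exponents combine as n K + 1 - (2K + 1) n / 2 = 1 - n / 2. *)
Lemma cumulant_ratio_le (R : realType) (a b lam kn k2 : R) (n K : nat) :
  0 <= a -> 0 < b -> 0 < lam ->
  `|kn| <= a * lam ^+ (n * K + 1) -> b * lam ^+ (2 * K).+1 <= k2 ->
  kn / k2 `^ (n%:R / 2) <= a / b `^ (n%:R / 2) * lam `^ (1 - n%:R / 2).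
Proof.
move=> a0 b0 lam0 kn_le k2_ge.
have b2 : 0 < b * lam ^+ (2 * K).+1 by rewrite mulr_gt0 // exprn_gt0.
have k2_gt0 : 0 < k2 := lt_le_trans b2 k2_ge.
have n2 : 0 <= n%:R / 2 :> R by rewrite divr_ge0.
have -> : a / b `^ (n%:R / 2) * lam `^ (1 - n%:R / 2) =
    a * lam ^+ (n * K + 1) / (b * lam ^+ (2 * K).+1) `^ (n%:R / 2).
  rewrite powRM ?exprn_ge0 ?ltW // -!powR_mulrn ?ltW // -powRrM invfM -!mulrA; congr (_ * _).
  rewrite mulrCA; congr (_ * _); rewrite -powRN -powRD; last by rewrite (gt_eqF lam0) implybT.
  by congr (_ `^ _); rewrite -[(2 * K).+1]addn1 !natrD !natrM; field.
apply: (@le_trans _ _ (`|kn| / k2 `^ (n%:R / 2))).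
  by rewrite ler_wpM2r ?invr_ge0 ?powR_ge0 ?ler_norm.
apply: ler_pM; rewrite ?invr_ge0 ?powR_ge0 //.
by rewrite lef_pV2 ?posrE ?powR_gt0 // ge0_ler_powR ?nnegrE ?(ltW b2) ?(ltW k2_gt0).
Qed.

Theorem mainTheorem13 (R : realType) (r : R) (hr : 0 < r)
    (k : nat) (hk : (2 <= k)%N)
    (t : R) (ht : k.-1%:R * r <= t < k%:R * r)
    (n : nat) (hn : (2 <= n)%N) :
  exists C lam0 : R, [/\ 0 < C, 0 < lam0 &
    forall lam : R, lam0 < lam ->
    forall (d : measure_display) (T : measurableType d) (P : probability T R)
      (X : T -> {fset R}),
      poisson_process P (k%:R * r) lam X ->
      hop_cumulant P X r k t n
        / (hop_cumulant P X r k t 2) `^ (n%:R / 2)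
      <= (n`!%:R) ^+ (k - 2) * (C * lam `^ (1 - n%:R / 2))].
Proof.
case: k hk ht => [|[|K]] //= _ /andP[t_ge t_lt].
have t_gt0 : 0 < t by apply: lt_le_trans t_ge; rewrite mulr_gt0.
(* The gap condition (s + 1) t <= k s r reads t <= s (k r - t), so s is taken above t / (k r - t);
   here t < k r enters. *)
pose s := (Num.truncn (t / (K.+2%:R * r - t))).+1.
have s_gap : s.+1%:R * t <= (K.+2 * s)%:R * r.
  have := truncnS_gt (t / (K.+2%:R * r - t)); rewrite -/s ltr_pdivrMr ?subr_gt0 //.
  by rewrite -natr1 natrM; lra.
pose D := (n * K + 1)%N.
(* Adding 1 makes [a], and with it the final constant, strictly positive. *)
pose a := cumulant_const R n * (D.+1 * (D ^ K.+1) ^ n)%:R * (1 + t) ^+ D + 1.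
pose b := (t / (2 * (K.+2 * s)%:R)) ^+ (2 * K).+1 / 2.
have a_gt0 : 0 < a.
  rewrite ltr_wpDl // !mulr_ge0 ?exprn_ge0 ?ler0n //; last by rewrite addr_ge0 // ltW.
  exact: sumr_ge0.
have b_gt0 : 0 < b by rewrite divr_gt0 // exprn_gt0 // divr_gt0 // mulr_gt0 // ltr0n muln_gt0.
exists (a / b `^ (n%:R / 2)), 1; split => //; first by rewrite divr_gt0 // powR_gt0.
move=> lam lam1 d T P X PX.
have lam0 := lt_trans ltr01 lam1.
apply: (@le_trans _ _ (a / b `^ (n%:R / 2) * lam `^ (1 - n%:R / 2))).
  apply: (@cumulant_ratio_le _ _ _ _ _ _ _ K (ltW a_gt0) b_gt0 lam0).
    (* The upper bound holds along any mesh, here the one with window parameter 1. *)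
    apply: le_trans (hop_cumulant_le r K t_gt0 (ltn0Sn 0) PX lam1 (ltW t_lt) (ltnW hn)) _.
    by rewrite ler_wpM2r ?exprn_ge0 ?(ltW lam0) // lerDl.
  exact: (hop_variance_ge t_gt0 (ltn0Sn _) PX lam1 (ltW t_lt) s_gap).
(* The factor (n!) ^ (k - 2) is at least 1 and only enlarges the right-hand side. *)
rewrite ler_peMl ?mulr_ge0 ?invr_ge0 ?powR_ge0 ?(ltW a_gt0) //.
by rewrite exprn_ege1 // ler1n fact_gt0.
Qed.
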